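(* Let $n=p_1^{\alpha_1}\cdots p_k^{\alpha_k}$, where $k\geq 1$, $\alpha_i\geq 1$ and the $p_i$ are distinct primes satisfying $p_i\equiv 1\pmod 4$ for all $i=1,\ldots,k$. Then: (1) if $p_i=5$ for some $i\in\{1,\ldots,k\}$, then the clique number of the Paley-type graph $G_n$ is $2$; and (2) if $p_i\in\{13,17\}$ for some $i\in\{1,\ldots,k\}$ and $5\nmid n$, then the clique number of $G_n$ is $3$.
   Context: For $n=p_1^{\alpha_1}\cdots p_k^{\alpha_k}$ with distinct primes $p_i\equiv 1\pmod 4$ and $\alpha_i\ge 1$, let $\mathbb{Z}_n^\ast$ be the group of units of the ring $\mathbb{Z}_n=\mathbb{Z}/n\mathbb{Z}$. The Paley-type graph $G_n$ is the simple undirected graph with vertex set $\mathbb{Z}_n$ in which $xy$ is an edge if and only if $x-y\equiv a^2\pmod n$ for some $a\in\mathbb{Z}_n^\ast$ (this is symmetric since $-1$ is a square in $\mathbb{Z}_n^\ast$). The clique number of a graph is the order of a clique of maximum size contained in the graph. *)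

(* Defs.v *)
From mathcomp Require Import all_boot all_order all_algebra.

Set Implicit Arguments.
Unset Strict Implicit.
Unset Printing Implicit Defensive.

Import GRing.Theory.

(* A graph on a finite type is given by its adjacency relation [e]. *)
Definition is_clique (T : finType) (e : rel T) (A : {set T}) : bool :=
  [forall x in A, forall y in A, (x != y) ==> e x y].

Definition clique_number (T : finType) (e : rel T) : nat :=
  \max_(A : {set T} | is_clique e A) #|A|.

(* Meaningful for 1 < n only, since 'Z_0 and 'Z_1 are both the ring Z/2.  When
   every prime factor of n is 1 modulo 4, -1 is the square of a unit and the
   relation is symmetric; it is irreflexive because 0 is not a unit. *)
Definition paley_graph (n : nat) : rel 'Z_n :=
  [rel x y | [exists a : 'Z_n,
                (a \is a GRing.unit) && (x - y == a ^+ 2)%R]].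

Arguments paley_graph : clear implicits.

(* Main.v *)
Require Import Defs.
From mathcomp Require Import all_boot all_order all_algebra.
From mathcomp Require Import finfield zify ring.

Set Implicit Arguments.
Unset Strict Implicit.
Unset Printing Implicit Defensive.

Import GRing.Theory.

(* Reduction modulo q sends the cliques of G_n injectively to cliques of G_q
   whenever q divides n, and the clique numbers of G_5, G_13 and G_17 are bounded
   by exhaustive search.  Conversely -1 is the square of a unit modulo n, so
   {0, 1} is a clique, and the identity 3 ^ 2 + 4 ^ 2 = 5 ^ 2 makes
   {0, 3 ^ 2, 5 ^ 2} a clique as soon as n is prime to 30. *)

(** * Square roots of -1 modulo n *)

(** With q = 4m + 1, any nonzero a such that a^(2m) <> 1 has a^(2m) = -1, so a^m is a root. *)
Lemma prime_dvd_sqr_add1 (q : nat) :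
  prime q -> q = 1 %[mod 4] -> exists x, q %| x ^ 2 + 1.
Proof.
move=> q_pr q4; have q_gt1 := prime_gt1 q_pr.
have [m Em] : exists m, q = (4 * m).+1 by exists (q %/ 4); lia.
have m_gt0 : 0 < m by lia.
have [a /andP[a0 a1]] :
    exists a : 'F_q, (a != 0)%R && (a ^+ (2 * m) != 1)%R.
  (* Otherwise X^(2m) - 1 would have all 4m nonzero elements as roots, more than its degree. *)
  apply/existsP; apply: contraT => /existsPn Hall.
  pose P : {poly 'F_q} := ('X^(2 * m) - 1)%R.
  have sP : size P = (2 * m).+1 by rewrite size_XnsubC // muln_gt0.
  have P0 : P != 0%R by rewrite -size_poly_eq0 sP.
  have := @max_poly_roots _ P (enum [pred a : 'F_q | a != 0%R]) P0.
  rewrite enum_uniq -cardE sP => /(_ _ isT).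
  rewrite (_ : #|_| = q.-1); last first.
    have /= := cardC1 (0%R : 'F_q).
    by rewrite card_Fp // => <-; apply: eq_card.
  suff Hr : all (root P) (enum [pred a : 'F_q | a != 0%R]) by move/(_ Hr); lia.
  apply/allP => a; rewrite mem_enum inE => a0.
  have := Hall a; rewrite a0 negbK => /eqP Ha.
  by rewrite /root !hornerE Ha subrr.
have a4 : (a ^+ (4 * m) = 1)%R.
  apply: (mulfI a0); rewrite -exprS mulr1 -{2}[a]expf_card card_Fp //.
  by congr (_ ^+ _)%R.
have am1 : ((a ^+ m) ^+ 2 + 1 = 0)%R.
  have : ((a ^+ (2 * m) - 1) * (a ^+ (2 * m) + 1) = 0)%R.
    by rewrite -subr_sqr expr1n -exprM (_ : 2 * m * 2 = 4 * m) ?a4 ?subrr //; lia.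
  move/eqP; rewrite mulf_eq0 subr_eq0 (negPf a1) /= => /eqP.
  by rewrite -exprM mulnC.
exists (a ^+ m)%R.
by rewrite (dvdn_pcharf (pchar_Fp q_pr)) natrD natrX natr_Zp am1.
Qed.

Lemma coprime_dvd_sqr_add1 (m n x y : nat) : coprime m n ->
  m %| x ^ 2 + 1 -> n %| y ^ 2 + 1 -> exists z, m * n %| z ^ 2 + 1.
Proof.
move=> co mx ny; exists (chinese m n x y); rewrite Gauss_dvd //.
apply/andP; split.
  by rewrite /dvdn -modnDml -modnXm chinese_modl // modnXm modnDml.
by rewrite /dvdn -modnDml -modnXm chinese_modr // modnXm modnDml.
Qed.

(* Newton's iteration for x ^ 2 + 1, with (d + 1) / 2 as the inverse of 2
   modulo d. *)
Lemma lift_dvd_sqr_add1 (m d x : nat) : odd d -> d %| m ->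
  m %| x ^ 2 + 1 -> exists y, d * m %| y ^ 2 + 1.
Proof.
move=> d_odd dm mx; have du := dvdn_trans dm mx.
pose h := d.+1./2; have Eh : 2 * h = d.+1 by rewrite /h; lia.
set u := x ^ 2 + 1 in mx du.
(* Modulo d, x^2 = -1 makes -x the inverse of x, so the Newton correction -u/(2x) becomes x h u. *)
exists (x + x * h * u).
have -> : (x + x * h * u) ^ 2 + 1
    = x ^ 2 + 1 + (2 * h) * (x ^ 2 * u) + (x * h) ^ 2 * u ^ 2 by ring.
have -> : x ^ 2 + 1 + (2 * h) * (x ^ 2 * u) + (x * h) ^ 2 * u ^ 2
    = (u + d * x ^ 2 + (x * h) ^ 2 * u) * u by rewrite Eh /u; ring.
apply: dvdn_mul mx; apply: dvdn_add; last exact: dvdn_mull.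
by apply: dvdn_add => //; apply: dvdn_mulr.
Qed.

(** Strong induction, removing the least prime factor q from n = m q: Newton lifting restores q if
    it still divides m, the Chinese remainder theorem otherwise. *)
Lemma dvd_sqr_add1 (n : nat) : 0 < n ->
  (forall q, prime q -> q %| n -> q = 1 %[mod 4]) ->
  exists x, n %| x ^ 2 + 1.
Proof.
have [N] := ubnP n; elim: N n => // N IHN n nN n_gt0 n4.
have [n_le1 | n_gt1] := leqP n 1; first by exists 0; have -> : n = 1 by lia.
pose q := pdiv n; have q_pr : prime q by apply: pdiv_prime.
have q4 := n4 q q_pr (pdiv_dvd n).
have /dvdnP[m En] : q %| n := pdiv_dvd n.
have q_gt1 := prime_gt1 q_pr.
have m_gt0 : 0 < m by move: n_gt0; rewrite En muln_gt0 => /andP[].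
have mN : m < N.
  by rewrite -ltnS (leq_trans _ nN) // ltnS En ltn_Pmulr.
have [//|//|r r_pr rm|x mx] := IHN m.
  by apply: n4 => //; rewrite En dvdn_mulr.
have [qm | qm] := boolP (q %| m).
  by rewrite En mulnC; apply: lift_dvd_sqr_add1 qm mx; lia.
have [y qy] := prime_dvd_sqr_add1 q_pr q4.
rewrite En mulnC; apply: coprime_dvd_sqr_add1 qy mx.
by rewrite prime_coprime.
Qed.

(** * Reduction modulo a divisor *)

Section Reduction.

Variables n q : nat.
Hypotheses (n_gt1 : 1 < n) (q_gt1 : 1 < q) (q_dvd_n : q %| n).

Definition Zp_reduce (x : 'Z_n) : 'Z_q := (x : nat)%:R%R.

(** As q divides n, the remainder modulo n keeps the class modulo q. Additivity and multiplicativity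
    follow by writing residues as casts of naturals. *)
Lemma Zp_reduce_nat (m : nat) : Zp_reduce m%:R%R = m%:R%R.
Proof.
by apply: val_inj; rewrite /Zp_reduce val_Zp_nat //= !val_Zp_nat // modn_dvdm.
Qed.

Lemma Zp_reduceD : {morph Zp_reduce : x y / (x + y)%R}.
Proof.
by move=> x y; rewrite -[x]natr_Zp -[y]natr_Zp -natrD !Zp_reduce_nat natrD.
Qed.

Lemma Zp_reduceM : {morph Zp_reduce : x y / (x * y)%R}.
Proof.
by move=> x y; rewrite -[x]natr_Zp -[y]natr_Zp -natrM !Zp_reduce_nat natrM.
Qed.

Lemma Zp_reduceB : {morph Zp_reduce : x y / (x - y)%R}.
Proof.
by move=> x y; apply: (addIr (Zp_reduce y)); rewrite -Zp_reduceD !subrK.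
Qed.

Lemma Zp_reduce_unit (x : 'Z_n) :
  x \is a GRing.unit -> Zp_reduce x \is a GRing.unit.
Proof.
rewrite -{1}[x]natr_Zp /Zp_reduce !unitZpE //.
exact: coprime_dvdl.
Qed.

Lemma paley_graph_reduce (x y : 'Z_n) :
  paley_graph n x y -> paley_graph q (Zp_reduce x) (Zp_reduce y).
Proof.
move=> /existsP[a /andP[ua /eqP xy]]; apply/existsP; exists (Zp_reduce a).
by rewrite Zp_reduce_unit //= -Zp_reduceB xy !expr2 Zp_reduceM.
Qed.

Lemma paley_graph_irrefl (x : 'Z_q) : ~~ paley_graph q x x.
Proof.
apply/existsPn => a; rewrite subrr; apply/negP => /andP[ua /eqP a0].
by have := unitrX 2 ua; rewrite -a0 unitr0.
Qed.

(** Two distinct vertices of a clique with the same image would give a loop in G_q, so reduction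
    preserves the size of the clique. *)
Lemma leq_clique_number_paley :
  clique_number (paley_graph n) <= clique_number (paley_graph q).
Proof.
apply/bigmax_leqP => A /forall_inP clA.
have adjA x y : x \in A -> y \in A -> x != y -> paley_graph n x y.
  by move=> xA yA; apply/implyP; apply: (forall_inP (clA x xA)).
rewrite -(card_in_imset (f := Zp_reduce) (D := mem A)); last first.
  move=> x y xA yA Exy; apply/eqP/negPn/negP => /(adjA x y xA yA).
  by move/paley_graph_reduce; rewrite Exy (negPf (paley_graph_irrefl _)).
apply: leq_bigmax_cond; apply/forall_inP => _ /imsetP[x xA ->].
apply/forall_inP => _ /imsetP[y yA ->]; apply/implyP => fxy.
by apply/paley_graph_reduce/adjA => //; apply: contraNneq fxy => ->.
Qed.

End Reduction.

(** * Exhaustive clique search *)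

(** Here [c] holds the common neighbours of the vertices chosen so far and [k] counts those still to
    be chosen; reaching 0 means that a clique was found. *)
Fixpoint no_clique (T : Type) (e : rel T) (k : nat) (c : seq T) : bool :=
  if k is k'.+1 then all (fun x => no_clique e k' (filter (e x) c)) c
  else false.

Lemma no_cliqueP (T : eqType) (e : rel T) k (c s : seq T) :
  no_clique e k c -> pairwise e s -> {subset s <= c} -> size s < k.
Proof.
elim: k c s => // k IHk c [|x s] //= /allP cl /andP[/allP xs ps] sc.
apply: IHk (cl x _) ps _; first by rewrite sc ?mem_head.
by move=> y ys; rewrite mem_filter xs //= sc // inE ys orbT.
Qed.

(** A version on naturals that [vm_compute] can evaluate. For x, y < q the truncated q - y is exact.
    The root runs over all nonzero residues, so the graph contains G_q, which is enough for upper
    bounds. *)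
Definition paley_nat (q : nat) : rel nat :=
  fun x y => has (fun a => (x + (q - y)) %% q == a ^ 2 %% q) (iota 1 q.-1).

Lemma paley_graph_nat (q : nat) (x y : 'Z_q.+2) :
  paley_graph q.+2 x y -> paley_nat q.+2 x y.
Proof.
move=> /existsP[a /andP[ua /eqP /(congr1 val) xy]].
apply/hasP; exists (val a).
  rewrite mem_iota /= add1n ltn_ord andbT lt0n.
  by apply: contraTneq ua => a0; rewrite (_ : a = 0%R) ?unitr0 //; apply: val_inj.
move: xy; rewrite expr2 /= modnDmr => ->.
by rewrite mulnn.
Qed.

Lemma clique_number_paley_lt (q k : nat) :
  no_clique (paley_nat q.+2) k (iota 0 q.+2) ->
  clique_number (paley_graph q.+2) < k.
Proof.
move=> cl; have k_gt0 : 0 < k by case: k cl.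
rewrite -(prednK k_gt0) ltnS; apply/bigmax_leqP => A /forall_inP clA.
rewrite -ltnS prednK // cardE -(size_map val).
apply: no_cliqueP cl _ _; last first.
  by move=> _ /mapP[x _ ->]; rewrite mem_iota /= add0n ltn_ord.
rewrite pairwise_map.
have sub : {subset enum A <= A} by move=> x; rewrite mem_enum.
(* Cliques only relate distinct vertices, so uniqueness is carried through the induction. *)
elim: (enum A) (enum_uniq A) sub => //= x s IHs /andP[xs us] sub.
rewrite IHs // => [|y ys]; last by rewrite sub // inE ys orbT.
rewrite andbT; apply/allP => y ys; apply: paley_graph_nat.
have xA : x \in A by rewrite sub ?mem_head.
have yA : y \in A by rewrite sub // inE ys orbT.
by apply: (implyP (forall_inP (clA x xA) y yA)); apply: contraNneq xs => ->.
Qed.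

(** * Lower bounds from explicit cliques *)

Lemma clique_number_edge (T : finType) (e : rel T) (x y : T) :
  x != y -> e x y -> e y x -> 1 < clique_number e.
Proof.
move=> xy exy eyx; rewrite (_ : 2 = #|[set x; y]|); last by rewrite cards2 xy.
apply: leq_bigmax_cond; apply/forall_inP => a; rewrite !inE => Ha.
apply/forall_inP => b; rewrite !inE => Hb; apply/implyP.
by case/orP: Ha => /eqP->; case/orP: Hb => /eqP->; rewrite ?eqxx.
Qed.

Lemma clique_number_triangle (T : finType) (e : rel T) (x y z : T) :
  (forall t, ~~ e t t) ->
  e x y -> e y x -> e y z -> e z y -> e z x -> e x z -> 2 < clique_number e.
Proof.
move=> irr xy yx yz zy zx xz.
have neq a b : e a b -> a != b by apply: contraTneq => ->; apply: irr.
rewrite (_ : 3 = #|z |: [set x; y]|); last first.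
  by rewrite cardsU1 cards2 !inE negb_or !neq.
apply: leq_bigmax_cond; apply/forall_inP => a; rewrite !inE => Ha.
apply/forall_inP => b; rewrite !inE => Hb; apply/implyP.
by case/or3P: Ha => /eqP->; case/or3P: Hb => /eqP->; rewrite ?eqxx.
Qed.

Section LowerBounds.

Variables n x : nat.
Hypotheses (n_gt1 : 1 < n) (nx : n %| x ^ 2 + 1).

(** One direction has root c; the other has root x c, because x^2 = -1 in ['Z_n]. *)
Lemma paley_graph_natr (a b c : nat) : coprime n c -> a = b + c ^ 2 ->
  paley_graph n a%:R%R b%:R%R && paley_graph n b%:R%R a%:R%R.
Proof.
move=> co ->.
have x2 : ((x%:R : 'Z_n) ^+ 2 = -1)%R.
  apply/eqP; rewrite -addr_eq0 -natrX -(natrD _ _ 1); apply/eqP/val_inj.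
  by rewrite /= val_Zp_nat //; apply/eqP.
have uc : (c%:R : 'Z_n)%R \is a GRing.unit by rewrite unitZpE.
have ux : (x%:R : 'Z_n)%R \is a GRing.unit.
  by rewrite -(unitrX_pos _ (n := 2)) // x2 unitrN1.
apply/andP; split; apply/existsP.
  by exists c%:R%R; rewrite uc natrD natrX addrC addKr eqxx.
exists (x%:R * c%:R)%R; rewrite unitrM ux uc exprMn x2 natrD natrX.
by rewrite opprD addrA subrr sub0r mulN1r eqxx.
Qed.

Lemma clique_number_paley_ge2 : 1 < clique_number (paley_graph n).
Proof.
have /andP[e10 e01] := @paley_graph_natr 1 0 1 (coprimen1 n) (erefl _).
exact: clique_number_edge (oner_neq0 _) e10 e01.
Qed.

Lemma clique_number_paley_ge3 :
  coprime n 30 -> 2 < clique_number (paley_graph n).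
Proof.
move=> co.
(* The square is there for c = 4, which divides 900 but not 30. *)
have co' c : c %| 30 ^ 2 -> coprime n c.
  by move=> c30; apply: coprime_dvdr c30 _; rewrite coprimeXr.
have /andP[e1 e1'] := @paley_graph_natr 9 0 3 (co' 3 isT) (erefl _).
have /andP[e2 e2'] := @paley_graph_natr 25 9 4 (co' 4 isT) (erefl _).
have /andP[e3 e3'] := @paley_graph_natr 25 0 5 (co' 5 isT) (erefl _).
exact: clique_number_triangle (@paley_graph_irrefl n) e1 e1' e3' e3 e2 e2'.
Qed.

End LowerBounds.

(** * Combination of the bounds *)

Theorem corollary1p8 (n k : nat) (p alpha : 'I_k -> nat)
    (hk : 1 <= k)
    (hp : forall i, prime (p i))
    (hinj : injective p)
    (hp4 : forall i, p i = 1 %[mod 4])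
    (halpha : forall i, 1 <= alpha i)
    (hn : n = \prod_(i < k) p i ^ alpha i) :
  ((exists i, p i = 5) -> clique_number (paley_graph n) = 2) /\
  ((exists i, p i = 13 \/ p i = 17) -> ~~ (5 %| n) ->
     clique_number (paley_graph n) = 3).
Proof.
have n_gt0 : 0 < n by rewrite hn prodn_gt0 // => i; rewrite expn_gt0 prime_gt0.
have pn i : p i %| n.
  by rewrite hn (bigD1 i) //= dvdn_mulr // dvdn_exp.
have n_gt1 : 1 < n.
  by apply: leq_trans (dvdn_leq n_gt0 (pn (Ordinal hk))); apply: prime_gt1.
have n4 q : prime q -> q %| n -> q = 1 %[mod 4].
  move=> q_pr; rewrite hn.
  (* By Euclid's lemma, a prime dividing the product is one of the [p i]. *)
  elim/big_ind: _ => [|a b IHa IHb|i _].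
  - by rewrite Euclid_dvd1.
  - by rewrite Euclid_dvdM // => /orP[].
  - by rewrite Euclid_dvdX // dvdn_prime2 // => /andP[/eqP-> _].
have [x nx] := dvd_sqr_add1 n_gt0 n4.
have upper q m : q.+2 %| n ->
    no_clique (paley_nat q.+2) m.+1 (iota 0 q.+2) ->
  clique_number (paley_graph n) <= m.
  move=> qn /clique_number_paley_lt.
  exact: leq_trans (leq_clique_number_paley n_gt1 _ qn).
split=> [[i p5] | [i p1317] n5]; apply/eqP; rewrite eqn_leq.
  rewrite (clique_number_paley_ge2 n_gt1 nx) andbT.
  (* Modulus 3 + 2 = 5, where the search excludes cliques of size 3. *)
  by apply: (upper 3 2); [rewrite -p5 | vm_compute].
apply/andP; split.
  (* Moduli 13 and 17, where the search excludes cliques of size 4. *)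
  case: p1317 => Ep; [apply: (upper 11 3) | apply: (upper 15 3)];
    by [rewrite -Ep | vm_compute].
apply: clique_number_paley_ge3 nx _ => //.
(* The primes 2 and 3 do not divide n, not being 1 modulo 4; 5 is excluded by hypothesis. *)
rewrite (_ : 30 = 2 * (3 * 5)) // !coprimeMr.
by rewrite ![coprime n _]coprime_sym !prime_coprime // n5 andbT;
   apply/andP; split; apply/negP => /n4 => /(_ isT).
Qed.
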